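(* Fix $\beta > 0$ and positive integers $n,p,k$ such that $n = pk$. Let $\{J_i\}_{i=1}^{k}$ be any partition of $\{1,\dots,n\}$ with $|J_i| = p$, and denote by $S_i \in \mathbb{R}^{n\times p}$ the column selector for partition $J_i$. Suppose the random matrix $S \in \mathbb{R}^{n\times p}$ takes on value $S_i$ with probability $1/k$, for $i=1,\dots,k$. Let $A_{1,\beta} = I + \frac{\beta}{n}\mathbf{1}_n\mathbf{1}_n^{T}\in\mathbb{R}^{n\times n}$ and $\mu_{\mathrm{part}} = \lambda_{\min}\big(\mathbb{E}[P_{A_{1,\beta}^{1/2}S}]\big)$. Then $$\mu_{\mathrm{part}} = \frac{p}{n+\beta p}.$$
   Context: $\mathbf{1}_n \in \mathbb{R}^n$ is the all-ones vector and $I$ is the $n\times n$ identity. For a matrix $M$, $P_M$ denotes the orthogonal projector onto the range of $M$; for positive semi-definite $M$, $M^{1/2}$ is its positive semi-definite square root; $\lambda_{\min}$ denotes the smallest eigenvalue. The expectation is over the random choice of $S$. For an index set $J\subseteq\{1,\dots,n\}$ with $|J|=p$, the column selector matrix is $S(J) = (e_{J(1)},\dots,e_{J(p)}) \in \mathbb{R}^{n\times p}$, where $e_i$ is the $i$-th standard basis vector of $\mathbb{R}^n$ and $J(1),\dots,J(p)$ is any ordering of the elements of $J$.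
   Formalization: The positive integer k is required to be at least 2, because for k = 1 (p = n) the matrix S_1 is a permutation matrix, the expected projector is I and μ_part = 1, whereas the formula gives 1/(1+β) < 1. *)

(* Defs.v *)
From HB Require Import structures.
From mathcomp Require Import all_boot all_order all_algebra.
From mathcomp Require Import all_classical all_reals all_analysis.

Set Implicit Arguments.
Unset Strict Implicit.
Unset Printing Implicit Defensive.

Import Order.TTheory GRing.Theory Num.Theory.

Local Open Scope ring_scope.

Definition is_ordering (n p : nat) (J : {set 'I_n}) (s : 'I_p -> 'I_n) : Prop :=
  injective s /\ J =i codom s.

(* Column b is the standard basis vector e_(s b). *)
Definition column_selector (R : realType) (n p : nat) (s : 'I_p -> 'I_n) :
    'M[R]_(n, p) :=
  \matrix_(a < n, b < p) (a == s b)%:R.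

Definition symmetric_psd (R : realType) (n : nat) (M : 'M[R]_n) : Prop :=
  M^T = M /\ forall x : 'cV[R]_n, 0 <= (x^T *m M *m x) 0 0.

(* A positive semi-definite M has exactly one positive semi-definite square
   root; the default value 0 is only returned when there is none. *)
Definition psd_sqrt (R : realType) (n : nat) (M : 'M[R]_n) : 'M[R]_n :=
  xget 0 [set B : 'M[R]_n | symmetric_psd B /\ B *m B = M]%classic.

(* MathComp compares row spaces, hence the transposes: the last conjunct says
   that Q and M have the same range (column space). *)
Definition is_orthogonal_projector (R : realType) (n p : nat)
    (M : 'M[R]_(n, p)) (Q : 'M[R]_n) : Prop :=
  [/\ Q^T = Q, Q *m Q = Q & (Q^T == M^T)%MS].

(* The orthogonal projector onto the range of M exists and is unique, so the
   default value 0 plays no role. *)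
Definition range_projector (R : realType) (n p : nat) (M : 'M[R]_(n, p)) :
    'M[R]_n :=
  xget 0 [set Q : 'M[R]_n | is_orthogonal_projector M Q]%classic.

Definition is_smallest_eigenvalue (R : realType) (n : nat) (M : 'M[R]_n)
    (a : R) : Prop :=
  eigenvalue M a /\ forall b : R, eigenvalue M b -> a <= b.

(* The default value 0 is only returned when M has no real eigenvalue. *)
Definition lambda_min (R : realType) (n : nat) (M : 'M[R]_n) : R :=
  xget 0 [set a : R | is_smallest_eigenvalue M a]%classic.

Definition random_matrix (R : realType) (d : measure_display)
    (T : measurableType d) (n p : nat) (X : T -> 'M[R]_(n, p)) : Prop :=
  forall (a : 'I_n) (b : 'I_p),
    measurable_fun [set: T]%classic (fun w => X w a b).

Definition matrix_expectation (R : realType) (d : measure_display)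
    (T : measurableType d) (P : probability T R) (n p : nat)
    (X : T -> 'M[R]_(n, p)) : 'M[R]_(n, p) :=
  \matrix_(a < n, b < p) fine ('E_P[fun w => X w a b])%E.

Definition A1 (R : realType) (n : nat) (beta : R) : 'M[R]_n :=
  let ones : 'cV[R]_n := const_mx 1 in
  1%:M + (beta / n%:R) *: (ones *m ones^T).

Definition mu_part (R : realType) (d : measure_display) (T : measurableType d)
    (P : probability T R) (n p : nat) (beta : R) (S : T -> 'M[R]_(n, p)) : R :=
  lambda_min
    (matrix_expectation P
       (fun w => range_projector (psd_sqrt (A1 n beta) *m S w))).

(* Main.v *)
Require Import Defs.
From HB Require Import structures.
From mathcomp Require Import all_boot all_order all_algebra.
From mathcomp Require Import all_classical all_reals all_analysis.
From mathcomp Require Import measurable_realfun ring lra.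
Import Order.TTheory GRing.Theory Num.Theory.
Local Open Scope ring_scope.

(** Write 1 for the all-ones vector, J = 1 1^T, A = I + (beta/n) J, and let
    X be a symmetric square root of A. Put u_i = S_i 1, the indicator of the
    i-th block, and F = sum_i u_i u_i^T, the matrix with ones on the diagonal
    blocks.

    The columns of X S_i have Gram matrix S_i^T A S_i = I + (beta/n) 1 1^T,
    whose inverse is I - gamma 1 1^T with gamma = beta/(n + beta p); hence the
    projector onto the range of X S_i is
    X (S_i S_i^T - gamma u_i u_i^T) X ([range_projector_selector]). Since the
    blocks partition the indices, sum_i S_i S_i^T = I, so the expected
    projector is (1/k) X (I - gamma F) X.

    This is X times (I - gamma F) A times X^-1, up to the factor 1/k: only the
    spectrum of (I - gamma F) A is needed, and that matrix does not depend on
    the choice of X. As F^2 = p F and F J = J F = p J, this matrix acts as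
    scalars on three subspaces that span everything: 1 on the vectors summing to
    zero on each block, a = 1 - gamma p = n/(n + beta p) on the block-constant
    vectors of sum zero, and a (1 + beta) on the line of 1. The smallest of
    these is a ([smallest_eigenvalue_block]); it is attained because there are
    at least two blocks, so that u_0 - u_1 is a block-constant vector of sum
    zero. Dividing by k gives n/(k (n + beta p)) = p/(n + beta p).

    The expectation needs care: S may take arbitrary values on an event of
    probability zero, where nothing controls the measurability of the projector
    as a function of the sample point. [eq_integral_off_null] shows that such a
    change on a null set does not affect the integral, and
    [matrix_expectation_finite_law] computes the expectation of any function of
    a random matrix with finitely many values. *)

Set Implicit Arguments.
Unset Strict Implicit.
Unset Printing Implicit Defensive.

(** * Integrals of functions known off a null set *)

Section NullSet.
Context (d : measure_display) (T : measurableType d) (R : realType).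
Variable mu : {measure set T -> \bar R}.
Import HBNNSimple.
Local Open Scope classical_set_scope.
Local Open Scope ereal_scope.

(** Without measurability this is still immediate, because the integral of a
    nonnegative function is a supremum over the simple functions below it. *)
Lemma ge0_le_integral_nomeas (f g : T -> \bar R) :
  (forall x, 0 <= f x) -> (forall x, f x <= g x) ->
  \int[mu]_x f x <= \int[mu]_x g x.
Proof.
move=> f0 fg; have g0 x : 0 <= g x := le_trans (f0 x) (fg x).
rewrite !ge0_integralTE//; apply: le_ereal_sup => _ [h /= hf <-].
by exists h => // x; exact: le_trans (hf x) (fg x).
Qed.

(** [f] need not be measurable on [N], so almost-everywhere equality cannot be
    used directly: [f] is squeezed between the two measurable functions
    obtained from [g] by putting [0], respectively [+oo], on [N]. *)
Lemma ge0_eq_integral_off_null (N : set T) (f g : T -> \bar R) :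
  measurable N -> mu N = 0 -> measurable_fun setT g ->
  (forall x, 0 <= f x) -> (forall x, 0 <= g x) ->
  (forall x, ~ N x -> f x = g x) -> \int[mu]_x f x = \int[mu]_x g x.
Proof.
move=> mN N0 mg f0 g0 fg.
pose V c x : \bar R := if x \in N then c else g x.
have VE c : 0 <= c -> \int[mu]_x V c x = \int[mu]_x g x.
  move=> c0; apply: ge0_ae_eq_integral => //.
  - apply: measurable_fun_ifT => //.
    apply: (@measurable_fun_bool _ _ _ _ true).
    rewrite setTI (_ : _ @^-1` _ = N)//; apply/seteqP.
    by split=> x /=; [move/set_mem | move/mem_set].
  - by move=> x _; rewrite /V; case: ifP.
  - exists N; split=> // x /= xg; apply: contrapT => xN; apply: xg => _.
    by rewrite /V memNset.
apply/eqP; rewrite eq_le -{1}(VE +oo)// -(VE 0)//.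
apply/andP; split; apply: ge0_le_integral_nomeas => // x; rewrite /V;
  case: ifPn => // xN; rewrite ?leey// fg//; by move: xN; rewrite notin_setE.
Qed.

Lemma eq_integral_off_null (N : set T) (f g : T -> \bar R) :
  measurable N -> mu N = 0 -> measurable_fun setT g ->
  (forall x, ~ N x -> f x = g x) -> \int[mu]_x f x = \int[mu]_x g x.
Proof.
move=> mN N0 mg fg; rewrite integralE [RHS]integralE; congr (_ - _).
- apply: (ge0_eq_integral_off_null mN) => //; first exact: measurable_funepos.
  by move=> x /fg fgx; rewrite !funeposE fgx.
- apply: (ge0_eq_integral_off_null mN) => //; first exact: measurable_funeneg.
  by move=> x /fg fgx; rewrite !funenegE fgx.
Qed.

End NullSet.

(** * Random matrices with finitely many values *)

Section Discrete.
Context (d : measure_display) (T : measurableType d) (R : realType).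
Variable P : probability T R.
Local Open Scope classical_set_scope.

(** [h] is compared with the simple function that is [c i] on [A i] and zero
    elsewhere; they agree off a null set because the weights sum to one. *)
Lemma expectation_finite_events (k : nat) (A : 'I_k -> set T) (q c : 'I_k -> R)
    (h : T -> R) :
  (forall i, measurable (A i)) -> (forall i, P (A i) = (q i)%:E) ->
  trivIset setT A -> \sum_i q i = 1 -> (forall i x, A i x -> h x = c i) ->
  ('E_P[h] = (\sum_i q i * c i)%:E)%E.
Proof.
move=> mA PA tA q1 hA.
pose U := \big[setU/set0]_(i < k) A i.
have mU : measurable U by exact: bigsetU_measurable.
have PU : P (~` U) = 0%E.
  rewrite probability_setC// (_ : P U = 1%E) ?subee//.
  rewrite [LHS]measure_bigsetU_ord// -q1 -sumEFin.
  by apply: eq_bigr => i _; exact: PA.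
pose g x : R := \sum_i c i * \1_(A i) x.
have gE i x : A i x -> g x = c i.
  move=> Aix; rewrite /g (bigD1 i)//= indicE mem_set// mulr1 big1 ?addr0// => j ji.
  rewrite indicE memNset ?mulr0// => Ajx.
  by move/eqP: ji; apply; apply: tA => //; exists x.
rewrite unlock (@eq_integral_off_null _ _ _ P (~` U) _ (fun x => (g x)%:E)).
- rewrite /g; under eq_integral do rewrite -sumEFin.
  rewrite integral_sum//.
    rewrite -sumEFin; apply: eq_bigr => i _; under eq_integral do rewrite EFinM.
    rewrite integralZl//; last exact: integrable_indic.
    rewrite integral_indic// setIT mulrC EFinM; congr (_ * _)%E; exact: PA.
  move=> i; under eq_fun do rewrite EFinM.
  by apply: integrableZl => //; exact: integrable_indic.
- exact: measurableC.
- exact: PU.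
- by apply/measurable_EFinP/measurable_sum => i; exact: measurable_funM.
- move=> x /contrapT; rewrite /U -bigcup_seq => -[i _ Aix].
  by rewrite (hA _ _ Aix) (gE _ _ Aix).
Qed.

Lemma measurable_random_matrix_eq (n p : nat) (S : T -> 'M[R]_(n, p))
    (M : 'M[R]_(n, p)) : random_matrix S -> measurable [set w | S w = M].
Proof.
move=> mS.
suff -> : [set w | S w = M] = \big[setI/setT]_(ij : 'I_n * 'I_p)
    ((fun w => S w ij.1 ij.2) @^-1` [set M ij.1 ij.2]).
  apply: bigsetI_measurable => -[i j] _.
  by rewrite -[X in measurable X]setTI; apply: mS.
rewrite -bigcap_seq; apply/seteqP; split=> w /= Sw.
  by move=> [i j] _ /=; rewrite Sw.
by apply/matrixP => i j; apply: (Sw (i, j)); rewrite /= mem_index_enum.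
Qed.

(** The function [f] is arbitrary because the one of interest,
    [range_projector], is defined by a choice operator. *)
Lemma matrix_expectation_finite_law (n p m q k : nat) (S : T -> 'M[R]_(n, p))
    (M : 'I_k -> 'M[R]_(n, p)) (w : 'I_k -> R) (f : 'M[R]_(n, p) -> 'M[R]_(m, q)) :
  random_matrix S -> injective M ->
  (forall i, P [set x | S x = M i] = (w i)%:E) -> \sum_i w i = 1 ->
  matrix_expectation P (fun x => f (S x)) = \sum_i w i *: f (M i).
Proof.
move=> mS injM PS w1; apply/matrixP => a b; rewrite mxE summxE.
rewrite (@expectation_finite_events k (fun i => [set x | S x = M i]) w
  (fun i => f (M i) a b)) //=.
- by apply: eq_bigr => i _; rewrite mxE.
- by move=> i; exact: measurable_random_matrix_eq.
- by move=> i j _ _ [x [/= -> /injM]].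
- by move=> i x /= ->.
Qed.
End Discrete.

(** * Orthogonal projectors *)

Section Projector.
Context (R : realType).

(** Two symmetric idempotents with the same range absorb each other:
    Q1 Q2 = Q1 and Q2 Q1 = Q2, and transposing one identity gives the other
    value of the same product. *)
Lemma orthogonal_projector_unique (n p : nat) (M : 'M[R]_(n, p)) (Q1 Q2 : 'M[R]_n) :
  is_orthogonal_projector M Q1 -> is_orthogonal_projector M Q2 -> Q1 = Q2.
Proof.
have absorb Q Q' : is_orthogonal_projector M Q -> is_orthogonal_projector M Q' ->
    Q *m Q' = Q.
  move=> [sQ _ /eqmxP rQ] [sQ' iQ' /eqmxP rQ'].
  have /submxP[D QD] : (Q <= Q')%MS by rewrite -sQ -sQ' rQ rQ'.
  by rewrite {1}QD -mulmxA iQ' -QD.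
move=> P1 P2; have [[s1 _ _] [s2 _ _]] := (P1, P2).
by rewrite -(absorb _ _ P1 P2) -[LHS]trmxK trmx_mul s1 s2 (absorb _ _ P2 P1).
Qed.

(** The classical formula M (M^T M)^-1 M^T; the inverse [H] of the Gram matrix
    is automatically symmetric. *)
Lemma range_projectorE (n p : nat) (M : 'M[R]_(n, p)) (H : 'M[R]_p) :
  (M^T *m M) *m H = 1%:M -> range_projector M = M *m H *m M^T.
Proof.
move=> GH; have HG := mulmx1C GH.
have HT : H^T = H.
  have := congr1 trmx HG; rewrite !trmx_mul trmxK trmx1 => GHT.
  by rewrite -[RHS]mulmx1 -GHT mulmxA HG mul1mx.
have QT : (M *m H *m M^T)^T = M *m H *m M^T.
  by rewrite !trmx_mul trmxK HT mulmxA.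
suff PQ : is_orthogonal_projector M (M *m H *m M^T).
  by apply: xget_unique => // Q /orthogonal_projector_unique; apply.
split=> //.
- by rewrite -!mulmxA (mulmxA M^T) (mulmxA (M^T *m M)) GH mul1mx.
- rewrite QT; apply/andP; split; first exact: submxMl.
  by rewrite -[X in (X <= _)%MS]mul1mx -GH -!mulmxA submxMl.
Qed.

End Projector.

(** * Smallest eigenvalues *)

Section SmallestEigenvalue.
Context (R : realType) (n : nat).
Implicit Types (M V : 'M[R]_n) (a : R).

Lemma lambda_minE M a : is_smallest_eigenvalue M a -> lambda_min M = a.
Proof.
move=> [eM lM]; apply: xget_unique => // b [eb lb].
by apply/eqP; rewrite eq_le lb// lM.
Qed.

Lemma eigenvalue_conj V M a : V \in unitmx ->
  eigenvalue (V *m M *m invmx V) a = eigenvalue M a.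
Proof.
move=> uV; apply/eigenvalueP/eigenvalueP => -[v vM v0].
- exists (v *m V).
    by rewrite scalemxAl -vM !mulmxA mulmxKV.
  by apply: contra_neq v0 => vV; rewrite -(mulmxK uV v) vV mul0mx.
- exists (v *m invmx V).
    by rewrite !mulmxA mulmxKV// vM scalemxAl.
  by apply: contra_neq v0 => vV; rewrite -(mulmxKV uV v) vV mul0mx.
Qed.

Lemma smallest_eigenvalue_conj V M a : V \in unitmx ->
  is_smallest_eigenvalue M a ->
  is_smallest_eigenvalue (V *m M *m invmx V) a.
Proof.
move=> uV [eM lM]; split=> [|b]; first by rewrite eigenvalue_conj.
by rewrite eigenvalue_conj//; exact: lM.
Qed.

Lemma smallest_eigenvalueZ (c : R) M a : 0 < c ->
  is_smallest_eigenvalue M a -> is_smallest_eigenvalue (c *: M) (c * a).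
Proof.
move=> c0 [/eigenvalueP[v vM v0] lM]; split.
  by apply/eigenvalueP; exists v; rewrite // -scalemxAr vM scalerA.
move=> b /eigenvalueP[w wM w0]; rewrite mulrC -ler_pdivlMr//; apply: lM.
apply/eigenvalueP; exists w => //.
by rewrite mulrC -scalerA -wM -scalemxAr scalerA mulVf ?scale1r ?gt_eqF.
Qed.

(** The argument never identifies the square root: it uses only that the root
    is symmetric and squares to [M], which follows once some root exists. *)
Lemma psd_sqrtP M : (exists B : 'M[R]_n, symmetric_psd B /\ B *m B = M) ->
  symmetric_psd (psd_sqrt M) /\ psd_sqrt M *m psd_sqrt M = M.
Proof. by move=> exB; apply: (xgetPex 0 exB). Qed.

End SmallestEigenvalue.

(** * Rank-one perturbations of the identity along the all-ones vector *)

Section RankOne.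
Context (R : realType).
Local Notation ones n := (const_mx 1 : 'cV[R]_n).
Local Notation J n := (ones n *m (ones n)^T).

Lemma onesT_ones n : (ones n)^T *m ones n = n%:R%:M.
Proof.
apply/matrixP => i j; rewrite !ord1 !mxE eqxx mulr1n.
rewrite (eq_bigr (fun=> 1)) ?sumr_const ?card_ord// => l _.
by rewrite !mxE mulr1.
Qed.

Lemma mul_J n : J n *m J n = n%:R *: J n.
Proof.
by rewrite -mulmxA (mulmxA _ (ones n)) onesT_ones mul_scalar_mx scalemxAr.
Qed.

Lemma mul_addJ n (x y : R) :
  (1%:M + x *: J n) *m (1%:M + y *: J n) = 1%:M + (x + y + n%:R * x * y) *: J n.
Proof.
rewrite mulmxDl !mulmxDr !mul1mx mulmx1 -scalemxAl -scalemxAr mul_J !scalerA.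
by rewrite addrA -!addrA -!scalerDl; congr (_ + _ *: _); ring.
Qed.

Lemma psd_addJ n (x : R) : 0 <= x -> symmetric_psd (1%:M + x *: J n).
Proof.
move=> x0; split.
  by rewrite linearD /= linearZ /= trmx1 trmx_mul trmxK.
move=> v; rewrite mulmxDr mulmxDl mulmx1 -scalemxAr -scalemxAl mxE.
have sq m (w : 'cV[R]_m) : 0 <= (w^T *m w) 0 0.
  by rewrite mxE sumr_ge0// => i _; rewrite mxE -expr2 sqr_ge0.
rewrite addr_ge0// mxE mulr_ge0//.
suff -> : v^T *m J n *m v = ((ones n)^T *m v)^T *m ((ones n)^T *m v) by exact: sq.
by rewrite trmx_mul trmxK !mulmxA.
Qed.

(** Squaring I + (t/n) J replaces 1 + t by its square on the line of the
    all-ones vector, so t = sqrt (1 + beta) - 1. *)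
Lemma A1_sqrt n (beta : R) : (0 < n)%N -> 0 <= beta ->
  exists B : 'M[R]_n, symmetric_psd B /\ B *m B = A1 n beta.
Proof.
move=> n0 b0; have nN0 : n%:R != 0 :> R by rewrite pnatr_eq0 -lt0n.
pose t := Num.sqrt (1 + beta) - 1.
have t1 : (1 + t) ^+ 2 = 1 + beta by rewrite addrC subrK sqr_sqrtr//; lra.
exists (1%:M + (t / n%:R) *: J n); split.
  apply: psd_addJ; rewrite divr_ge0// subr_ge0 -[leLHS]sqrtr1 ler_sqrt; lra.
rewrite mul_addJ /A1; congr (_ + _ *: _).
have -> : beta = (1 + t) ^+ 2 - 1 by rewrite t1; ring.
by field.
Qed.

Lemma A1_unit n (beta : R) : (0 < n)%N -> 0 <= beta -> A1 n beta \in unitmx.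
Proof.
move=> n0 b0; have nN0 : n%:R != 0 :> R by rewrite pnatr_eq0 -lt0n.
have bN0 : 1 + beta != 0 by rewrite gt_eqF//; lra.
apply: (proj1 (@mulmx1_unit _ _ _ (1%:M + (- (beta / (n%:R * (1 + beta)))) *: J n) _)).
rewrite /A1 mul_addJ (_ : _ + _ + _ = 0) ?scale0r ?addr0//.
by field; rewrite nN0 bN0.
Qed.
End RankOne.

(** * Spectrum of the product of the two perturbations *)

Section BlockSpectrum.
Context (R : realType) (n p : nat) (beta : R).
Hypotheses (n_gt0 : (0 < n)%N) (beta_gt0 : 0 < beta).
Local Notation J := ((const_mx 1 : 'cV[R]_n) *m (const_mx 1 : 'cV[R]_n)^T).
Local Notation gamma := (beta / (n%:R + beta * p%:R)).
Local Notation a := (n%:R / (n%:R + beta * p%:R)).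

(** If [c] is the eigenvalue of a row vector [w], multiplying the eigenvalue
    equation by [J], by [F], or not at all identifies [c] with [a (1 + beta)],
    [a] or [1], according to which of w J, w F is the first nonzero one. The
    vector [w0] witnesses that [a] itself occurs. *)
Lemma smallest_eigenvalue_block (F : 'M[R]_n) :
    F *m F = p%:R *: F -> F *m J = p%:R *: J -> J *m F = p%:R *: J ->
    (exists2 w : 'rV[R]_n, w *m F = p%:R *: w /\ w *m J = 0 & w != 0) ->
  is_smallest_eigenvalue ((1%:M - gamma *: F) *m A1 n beta) a.
Proof.
move=> FF FJ JF [w0 [w0F w0J] w0N0].
have n0 : 0 < n%:R :> R by rewrite ltr0n.
have bp0 : 0 <= beta * p%:R by rewrite mulr_ge0// ltW.
have d0 : 0 < n%:R + beta * p%:R by lra.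
have dN0 : n%:R + beta * p%:R != 0 by rewrite gt_eqF.
have nN0 : n%:R != 0 :> R by rewrite gt_eqF.
have aE : 1 - gamma * p%:R = a by field.
have a_gt0 : 0 < a by rewrite divr_gt0.
have a_le1 : a <= 1 by rewrite ler_pdivrMr// mul1r; lra.
set B := _ *m _.
have BE : B = 1%:M - gamma *: F + (beta / n%:R * a) *: J.
  rewrite /B /A1 mulmxDr mulmx1 mulmxBl mul1mx -scalemxAl -scalemxAr FJ !scalerA.
  by rewrite -scalerBl; congr (_ + _ *: _); field; rewrite nN0 dN0.
have BJ : B *m J = (a * (1 + beta)) *: J.
  rewrite BE mulmxDl mulmxBl mul1mx -!scalemxAl FJ mul_J !scalerA.
  rewrite -[X in X - _]scale1r -scalerBl -scalerDl aE.
  by congr (_ *: _); field; rewrite nN0 dN0.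
have BF : B *m F = a *: F + (beta / n%:R * a * p%:R) *: J.
  rewrite BE mulmxDl mulmxBl mul1mx -!scalemxAl FF JF !scalerA.
  by rewrite -[X in X - _]scale1r -scalerBl aE.
split.
  apply/eigenvalueP; exists w0 => //.
  rewrite BE mulmxDr mulmxBr mulmx1 -!scalemxAr w0F w0J scaler0 addr0 scalerA.
  by rewrite -[X in X - _]scale1r -scalerBl aE.
move=> c /eigenvalueP[w wB wN0].
have eig_eq m (Y : 'M[R]_(n, m)) y : w *m B *m Y = y *: (w *m Y) -> w *m Y != 0 -> c = y.
  rewrite wB -scalemxAl => /eqP; rewrite -subr_eq0 -scalerBl scaler_eq0 subr_eq0.
  by case/orP => [/eqP //|/eqP ->]; rewrite eqxx.
have [wJ|wJ] := eqVneq (w *m J) 0; last first.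
  rewrite (eig_eq _ _ (a * (1 + beta)) _ wJ).
    by rewrite ler_peMr ?(ltW a_gt0)// lerDl ltW.
  by rewrite -mulmxA BJ -scalemxAr.
have [wF|wF] := eqVneq (w *m F) 0; last first.
  rewrite (eig_eq _ _ a _ wF)//.
  by rewrite -mulmxA BF mulmxDr -!scalemxAr wJ scaler0 addr0.
rewrite (eig_eq _ 1%:M 1) ?mulmx1//.
by rewrite scale1r BE mulmxDr mulmxBr mulmx1 -!scalemxAr wJ wF !scaler0 subr0 addr0.
Qed.
End BlockSpectrum.

(** * Column selectors of a partition *)

Section Selectors.
Context (R : realType) (n p k : nat) (s : 'I_k -> 'I_p -> 'I_n).
Local Notation sel i := (column_selector R (s i)).
Local Notation ones m := (const_mx 1 : 'cV[R]_m).
Local Notation J m := (ones m *m (ones m)^T).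

Lemma selectorT_ones i : (sel i)^T *m ones n = ones p.
Proof.
apply/matrixP => b c; rewrite !mxE (bigD1 (s i b))//= !mxE eqxx mulr1 big1 ?addr0//.
by move=> x /negPf xb; rewrite !mxE xb mul0r.
Qed.

Lemma onesT_selector i : (ones n)^T *m sel i = (ones p)^T.
Proof. by rewrite -[LHS]trmxK trmx_mul trmxK selectorT_ones. Qed.

Hypothesis s_bij : bijective (fun ij : 'I_k * 'I_p => s ij.1 ij.2).

Lemma selectorT_selector i j :
  (sel i)^T *m sel j = if i == j then 1%:M else 0.
Proof.
apply/matrixP => b c; rewrite !mxE (bigD1 (s i b))//= !mxE eqxx mul1r big1 ?addr0.
  rewrite -[s i b]/((fun ij => s ij.1 ij.2) (i, b)).
  rewrite -[s j c]/((fun ij => s ij.1 ij.2) (j, c)) (inj_eq (bij_inj s_bij)).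
  by rewrite xpair_eqE; case: eqP; rewrite mxE.
by move=> x /negPf xb; rewrite !mxE xb mul0r.
Qed.

Lemma selector_inj : (0 < p)%N -> injective (fun i => sel i).
Proof.
move=> p0 i j ij; apply/eqP; apply: contraT => /negPf neq_ij.
have := selectorT_selector i j; rewrite -ij neq_ij selectorT_selector eqxx.
move/(congr1 (fun M : 'M[R]_p => M (Ordinal p0) (Ordinal p0))).
by rewrite !mxE eqxx => /eqP; rewrite oner_eq0.
Qed.

(** The columns of all the selectors together list each standard basis vector
    exactly once. *)
Lemma sum_selector_selectorT : \sum_i sel i *m (sel i)^T = 1%:M.
Proof.
apply/matrixP => x y; rewrite summxE mxE.
under eq_bigr do rewrite mxE; under eq_bigr do under eq_bigr do rewrite !mxE.
rewrite pair_bigA /=.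
rewrite -(reindex (fun ij : 'I_k * 'I_p => s ij.1 ij.2) (P := predT)
  (F := fun z => (x == z)%:R * (y == z)%:R))/=; last exact: onW_bij.
rewrite (bigD1 x)//= eqxx mul1r eq_sym big1 ?addr0// => z /negPf zx.
by rewrite eq_sym zx mul0r.
Qed.

(** The Gram matrix of [X *m sel i] is I + (beta/n) 1 1^T of size [p], and
    gamma = beta / (n + beta p) is the coefficient for which I - gamma 1 1^T is
    its inverse. *)
Lemma range_projector_selector (beta : R) (X : 'M[R]_n) i :
  (0 < n)%N -> 0 <= beta -> X^T = X -> X *m X = A1 n beta ->
  range_projector (X *m sel i) =
    X *m (sel i *m (sel i)^T - (beta / (n%:R + beta * p%:R)) *:
      ((sel i *m ones p) *m (sel i *m ones p)^T)) *m X.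
Proof.
move=> n_gt0 b0 XT XX; set gamma := beta / _.
have n0 : 0 < n%:R :> R by rewrite ltr0n.
have nN0 : n%:R != 0 :> R by rewrite gt_eqF.
have dN0 : n%:R + beta * p%:R != 0 by rewrite gt_eqF// ltr_wpDr// mulr_ge0.
rewrite (@range_projectorE _ _ _ _ (1%:M + (- gamma) *: J p)).
  rewrite trmx_mul XT !mulmxA; congr (_ *m X); rewrite -!mulmxA; congr (X *m _).
  rewrite !mulmxA mulmxDr mulmx1 mulmxDl -scalemxAr -scalemxAl scaleNr.
  by rewrite trmx_mul !mulmxA.
rewrite trmx_mul XT mulmxA -(mulmxA _ X X) XX /A1.
rewrite mulmxDr mulmx1 mulmxDl selectorT_selector eqxx.
rewrite -scalemxAr -scalemxAl mulmxA selectorT_ones -mulmxA.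
rewrite onesT_selector mul_addJ.
rewrite [X in X *: _](_ : _ = 0) ?scale0r ?addr0//.
by rewrite /gamma; field; rewrite nN0 dN0.
Qed.

(** Up to the factor [p], the orthogonal projector onto the block-constant
    vectors. *)
Definition block_ones : 'M[R]_n :=
  \sum_i (sel i *m ones p) *m (sel i *m ones p)^T.
Local Notation F := block_ones.

Lemma trmx_block : F^T = F.
Proof. by rewrite /F raddf_sum; apply: eq_bigr => i _ /=; rewrite trmx_mul trmxK. Qed.

Lemma block_mul_indicator i : F *m (sel i *m ones p) = p%:R *: (sel i *m ones p).
Proof.
rewrite mulmx_suml (bigD1 i)//= big1 ?addr0 => [|j ji].
  rewrite trmx_mul -!mulmxA (mulmxA (sel i)^T) selectorT_selector eqxx mul1mx.
  by rewrite onesT_ones mulmxA mul_mx_scalar.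
rewrite trmx_mul -!mulmxA (mulmxA (sel j)^T) selectorT_selector (negPf ji).
by rewrite mul0mx !mulmx0.
Qed.

Lemma sum_indicator : \sum_i sel i *m ones p = ones n.
Proof.
rewrite -[RHS]mul1mx -sum_selector_selectorT mulmx_suml; apply: eq_bigr => i _.
by rewrite -mulmxA selectorT_ones.
Qed.

Lemma block_mul_block : F *m F = p%:R *: F.
Proof.
rewrite {2}/F mulmx_sumr [RHS]scaler_sumr; apply: eq_bigr => i _.
by rewrite mulmxA block_mul_indicator -scalemxAl.
Qed.

Lemma block_mul_J : F *m J n = p%:R *: J n.
Proof.
rewrite mulmxA scalemxAl; congr (_ *m _); rewrite -sum_indicator mulmx_sumr scaler_sumr.
by apply: eq_bigr => i _; rewrite block_mul_indicator.
Qed.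

Lemma J_mul_block : J n *m F = p%:R *: J n.
Proof.
have JT : (J n)^T = J n by rewrite trmx_mul trmxK.
by rewrite -[LHS]trmxK trmx_mul JT trmx_block block_mul_J linearZ /= JT.
Qed.

(** The difference of the indicators of two blocks; it is nonzero because its
    product with the first indicator is [p]. *)
Lemma block_contrast : (0 < p)%N -> (1 < k)%N ->
  exists2 w : 'rV[R]_n, w *m F = p%:R *: w /\ w *m J n = 0 & w != 0.
Proof.
move=> p0 k1; pose i0 : 'I_k := Ordinal (ltnW k1); pose i1 : 'I_k := Ordinal k1.
pose u i := sel i *m ones p; have i01 : (i0 == i1) = false by [].
have uu i j : (u i)^T *m u j = (if i == j then p%:R else 0)%:M.
  rewrite /u trmx_mul -!mulmxA (mulmxA (sel i)^T) selectorT_selector.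
  by case: eqP => _; rewrite ?mul1mx ?onesT_ones// mul0mx mulmx0 raddf0.
have u1 i : (u i)^T *m ones n = p%:R%:M.
  by rewrite trmx_mul -mulmxA selectorT_ones onesT_ones.
exists (u i0 - u i1)^T; first split.
- rewrite -{1}trmx_block -trmx_mul mulmxBr !block_mul_indicator -scalerBr.
  by rewrite linearZ.
- by rewrite linearB /= mulmxA mulmxBl !u1 subrr mul0mx.
- apply/eqP => /(congr1 (fun v => (v *m u i0) 0 0)).
  rewrite linearB /= mulmxBl !uu eqxx eq_sym i01 mul0mx !mxE eqxx mulr1n mul0rn subr0.
  by move/eqP; rewrite pnatr_eq0 eqn0Ngt p0.
Qed.

End Selectors.

(** * The expected projector *)

(** Distinct blocks are disjoint and each ordering is injective, so the map is
    injective between sets of the same size. *)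
Lemma ordering_bij (n p k : nat) (J : 'I_k -> {set 'I_n}) (s : 'I_k -> 'I_p -> 'I_n) :
  n = (p * k)%N -> injective J ->
  finset.partition [set J i | i : 'I_k]%SET [set: 'I_n]%SET ->
  (forall i, is_ordering (J i) (s i)) ->
  bijective (fun ij : 'I_k * 'I_p => s ij.1 ij.2).
Proof.
move=> npk injJ /and3P[_ /finset.trivIsetP tJ _] sJ; apply: inj_card_bij; last first.
  by rewrite card_prod !card_ord npk mulnC.
move=> [i b] [j c] /= sbc.
have memJ l e : s l e \in J l by have [_ ->] := sJ l; exact: codom_f.
have ij : i = j.
  apply/eqP; apply: contraT => ij.
  have dJ : [disjoint J i & J j].
    by apply: tJ; rewrite ?imset_f// (inj_eq injJ).
  by have := disjointFr dJ (memJ i b); rewrite sbc memJ.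
by move: sbc; rewrite -ij => /(proj1 (sJ i)) ->.
Qed.

Theorem proposition3p1
    (R : realType) (beta : R) (n p k : nat)
    (beta_gt0 : 0 < beta)
    (n_gt0 : (0 < n)%N) (p_gt0 : (0 < p)%N) (k_gt1 : (1 < k)%N)
    (n_pk : n = (p * k)%N)
    (J : 'I_k -> {set 'I_n})
    (J_inj : injective J)
    (J_partition : finset.partition [set J i | i : 'I_k]%SET [set: 'I_n]%SET)
    (J_card : forall i : 'I_k, #|J i| = p)
    (s : 'I_k -> 'I_p -> 'I_n)
    (s_ordering : forall i : 'I_k, is_ordering (J i) (s i))
    (d : measure_display) (T : measurableType d) (P : probability T R)
    (S : T -> 'M[R]_(n, p))
    (S_random : random_matrix S)
    (S_law : forall i : 'I_k,
       P [set w : T | S w = column_selector R (s i)]%classic = (k%:R^-1)%:E) :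
  mu_part P beta S = p%:R / (n%:R + beta * p%:R).
Proof.
have s_bij := ordering_bij n_pk J_inj J_partition s_ordering.
have beta_ge0 := ltW beta_gt0.
have k0 : 0 < k%:R :> R by rewrite ltr0n ltnW.
have kN0 : k%:R != 0 :> R by rewrite gt_eqF.
have dN0 : n%:R + beta * p%:R != 0 by rewrite gt_eqF// ltr_wpDr ?mulr_ge0 ?ltr0n.
have [[XT _] XX] := psd_sqrtP (A1_sqrt n_gt0 beta_ge0).
rewrite /mu_part; set X := psd_sqrt _ in XT XX *.
pose sel i := column_selector R (s i).
pose gamma := beta / (n%:R + beta * p%:R).
have projE i := range_projector_selector s_bij i n_gt0 beta_ge0 XT XX.
have -> : matrix_expectation P (fun w => range_projector (X *m S w)) =
    k%:R^-1 *: (X *m (1%:M - gamma *: block_ones R s) *m X).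
  rewrite (@matrix_expectation_finite_law _ _ _ P _ _ _ _ _ S sel (fun=> k%:R^-1)
    (fun M => range_projector (X *m M)))//; last first.
  - by rewrite sumr_const card_ord -[LHS]mulr_natr mulVf.
  - exact: selector_inj.
  rewrite -scaler_sumr (eq_bigr _ (fun i _ => projE i)) -mulmx_suml -mulmx_sumr.
  by rewrite sumrB (sum_selector_selectorT R s_bij) -scaler_sumr.
apply: lambda_minE.
have Xu : X \in unitmx.
  have := A1_unit n_gt0 beta_ge0; rewrite -XX unitmx_mul.
  by case/andP.
have -> : p%:R / (n%:R + beta * p%:R) = k%:R^-1 * (n%:R / (n%:R + beta * p%:R)).
  by move: dN0; rewrite n_pk natrM => dN0; field; rewrite dN0 kN0.
apply: smallest_eigenvalueZ; first by rewrite invr_gt0.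
(* Conjugating by X removes the square root from the spectral problem. *)
have -> : X *m (1%:M - gamma *: block_ones R s) *m X =
    X *m ((1%:M - gamma *: block_ones R s) *m A1 n beta) *m invmx X.
  by rewrite -XX !mulmxA mulmxK.
apply: smallest_eigenvalue_conj => //.
apply: smallest_eigenvalue_block => //.
- exact: block_mul_block.
- exact: block_mul_J.
- exact: J_mul_block.
- exact: block_contrast.
Qed.
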